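(* Let $R$ be a ring with subring $S$ and let $\beta:S\to S$ be a ring automorphism. Then $R$ is a $\beta$-Frobenius extension of $S$ if and only if there exists a map $n:R\to S_\beta$ of $S$-$S$-bimodules such that $(S_\beta,n)$ is a Frobenius structure on $R$, where $R$ is regarded as an algebra object in the monoidal category of $S$-$S$-bimodules.
   Context: $S_\beta$ denotes the identity $S$-$S$-bimodule $S$ with right action twisted by $\beta$ (that is, $x\cdot s=x\beta(s)$). $R$ is a Frobenius extension of the second kind, or $\beta$-Frobenius extension, of $S$ if (1) $R$ is finitely generated and projective as a right $S$-module, and (2) there is an isomorphism $f:R\to\mathrm{Hom}_{\mathrm{mod}\text{-}S}(R,S_\beta)$ of $S$-$R$-bimodules, where $\mathrm{Hom}_{\mathrm{mod}\text{-}S}$ denotes homomorphisms of right $S$-modules (with left action $(sg)(x)=s\,g(x)$ and right action $(gr)(x)=g(rx)$). The category of $S$-$S$-bimodules is monoidal with $\otimes=\otimes_S$ and unit $\mathbf 1=S$; $R$ is an algebra object in it via its multiplication $m$ and the inclusion $u:S\to R$. An object $A$ of a monoidal category is left dualizable if there are an object $A^\vee$ and maps $e_A:A^\vee\otimes A\to\mathbf 1$, $c_A:\mathbf 1\to A\otimes A^\vee$ satisfying the triangle identities. A Frobenius structure on an algebra object $(A,m,u)$ consists of: $A$ left dualizable, together with a pair $(W,n)$ of an object $W$ and a map $n:A\to W$ such that, with $\kappa=n\circ m:A\otimes A\to W$, the map $\varphi=(\kappa\otimes1_{A^\vee})\circ(1_A\otimes c_A):A\to A\otimes A\otimes A^\vee\to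 W\otimes A^\vee$ is invertible. *)

(* Defs.v *)
From HB Require Import structures.
From mathcomp Require Import all_boot all_algebra.
From mathcomp Require Import boolp functions.
From mathcomp.multinomials Require Import freeg.

Set Implicit Arguments.
Unset Strict Implicit.
Unset Printing Implicit Defensive.

Import GRing.Theory.

Local Open Scope ring_scope.

HB.mixin Record Lmodule_isBimodule (S T : pzRingType) M of GRing.Lmodule S M := {
  ract : M -> T -> M;
  ractDl : forall a, {morph ract^~ a : x y / x + y};
  ractDr : forall x, {morph ract x : a b / a + b};
  ractA : forall x a b, ract (ract x a) b = ract x (a * b);
  ract1 : forall x, ract x 1 = x;
  scale_ract : forall (s : S) x a, s *: ract x a = ract (s *: x) a
}.

#[short(type="bimodType")]
HB.structure Definition Bimodule (S T : pzRingType) :=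
  {M of GRing.Lmodule S M & Lmodule_isBimodule S T M}.

Notation "x :* a" := (ract x a) (at level 40) : ring_scope.

(* The underlying right T-module; as usual in MathComp, right T-modules are
   left modules over the converse ring T^c. *)
Definition right_module (S T : pzRingType) (M : bimodType S T) : Type := M.

Section RightModule.
Variables (S T : pzRingType) (M : bimodType S T).

HB.instance Definition _ := GRing.Zmodule.on (right_module M).

Let rscale (a : T^c) (x : right_module M) : right_module M := (x : M) :* a.

Fact rscaleA a b x : rscale a (rscale b x) = rscale (a * b) x.
Proof. exact: ractA. Qed.
Fact rscale1 : left_id 1 rscale. Proof. exact: ract1. Qed.
Fact rscaleDr : right_distributive rscale +%R.
Proof. by move=> a; apply: ractDl. Qed.
Fact rscaleDl x : {morph rscale^~ x : a b / a + b}.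
Proof. by move=> a b; apply: (ractDr (x : M)). Qed.

HB.instance Definition _ := GRing.Zmodule_isLmodule.Build T^c (right_module M)
  rscaleA rscale1 rscaleDr rscaleDl.

Lemma rmodZE (a : T^c) (x : right_module M) : a *: x = (x : M) :* a.
Proof. by []. Qed.

End RightModule.

Record bimod_hom (S T : pzRingType) (M N : bimodType S T) := BimodHom {
  bimod_fun :> {linear M -> N};
  bimod_funR : forall x a, bimod_fun (x :* a) = bimod_fun x :* a
}.

Definition is_bimod_iso (S T : pzRingType) (M N : bimodType S T)
    (f : bimod_hom M N) :=
  exists g : bimod_hom N M, cancel f g /\ cancel g f.

(* The ring R as an S-T-bimodule via ring morphisms f : S -> R, g : T -> R:
   s . x . t = f s * x * g t. *)
Definition ring_bimod (S T R : pzRingType)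
  (f : {rmorphism S -> R}) (g : {rmorphism T -> R}) : Type := R.

Section RingBimod.
Variables (S T R : pzRingType) (f : {rmorphism S -> R}) (g : {rmorphism T -> R}).
Local Notation M := (ring_bimod f g).

HB.instance Definition _ := GRing.Zmodule.on M.

Let rb_scale (s : S) (x : M) : M := f s * (x : R).
Let rb_ract (x : M) (a : T) : M := (x : R) * g a.

Fact rb_scaleA a b x : rb_scale a (rb_scale b x) = rb_scale (a * b) x.
Proof. by rewrite /rb_scale rmorphM mulrA. Qed.
Fact rb_scale1 : left_id 1 rb_scale.
Proof. by move=> x; rewrite /rb_scale rmorph1 mul1r. Qed.
Fact rb_scaleDr : right_distributive rb_scale +%R.
Proof. by move=> a x y; apply: mulrDr. Qed.
Fact rb_scaleDl x : {morph rb_scale^~ x : a b / a + b}.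
Proof. by move=> a b; rewrite /rb_scale rmorphD mulrDl. Qed.

HB.instance Definition _ := GRing.Zmodule_isLmodule.Build S M
  rb_scaleA rb_scale1 rb_scaleDr rb_scaleDl.

Fact rb_ractDl a : {morph rb_ract^~ a : x y / x + y}.
Proof. by move=> x y; apply: mulrDl. Qed.
Fact rb_ractDr x : {morph rb_ract x : a b / a + b}.
Proof. by move=> a b; rewrite /rb_ract rmorphD mulrDr. Qed.
Fact rb_ractA x a b : rb_ract (rb_ract x a) b = rb_ract x (a * b).
Proof. by rewrite /rb_ract rmorphM mulrA. Qed.
Fact rb_ract1 x : rb_ract x 1 = x.
Proof. by rewrite /rb_ract rmorph1 mulr1. Qed.
Fact rb_scale_ract (s : S) x a : s *: rb_ract x a = rb_ract (s *: x) a.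
Proof. exact: mulrA. Qed.

HB.instance Definition _ := Lmodule_isBimodule.Build S T M
  rb_ractDl rb_ractDr rb_ractA rb_ract1 rb_scale_ract.

Lemma rbZE (s : S) (x : M) : s *: x = f s * (x : R) :> R.
Proof. by []. Qed.
Lemma rbRE (x : M) (a : T) : x :* a = (x : R) * g a :> R.
Proof. by []. Qed.

End RingBimod.

Section RHom.
Variables (T U S : pzRingType) (M : bimodType T S) (N : bimodType U S).

Definition right_linear (h : M -> N) : Prop :=
  linear (h : right_module M -> right_module N).

Definition right_linearb : {pred M -> N} := fun h => `[< right_linear h >].

Lemma right_linearbP h : reflect (right_linear h) (h \in right_linearb).
Proof. exact: asboolP. Qed.

Fact right_linear_zmod : zmod_closed right_linearb.
Proof.
split=> [|g h /right_linearbP gL /right_linearbP hL].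
  by apply/right_linearbP => a x y; rewrite scaler0 addr0.
apply/right_linearbP => a x y.
rewrite [LHS](_ : _ = g (a *: x + y) - h (a *: x + y)) // gL hL.
by rewrite [in RHS](_ : (g - h) x = g x - h x) // scalerBr opprD addrACA.
Qed.

HB.instance Definition _ := GRing.isZmodClosed.Build (M -> N) right_linearb
  right_linear_zmod.

Record rhom := RHom { rhom_fun :> M -> N; _ : rhom_fun \in right_linearb }.

HB.instance Definition _ := [isSub for rhom_fun].
HB.instance Definition _ := [Choice of rhom by <:].
HB.instance Definition _ := [SubChoice_isSubZmodule of rhom by <:].

Lemma rhomP (h : rhom) : right_linear h.
Proof. by case: h => h hP; apply/right_linearbP. Qed.

Lemma rhomD (h : rhom) : {morph h : x y / x + y}.
Proof. by move=> x y; move: (rhomP h 1 x y); rewrite !scale1r. Qed.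

Lemma rhomR (h : rhom) x a : h (x :* a) = h x :* a.
Proof.
have h0 : h 0 = 0 by apply: (addIr (h 0)); rewrite -rhomD !add0r.
by move: (rhomP h a x 0); rewrite h0 !addr0 !rmodZE.
Qed.

Lemma right_linearP (h : M -> N) : {morph h : x y / x + y} ->
  (forall x a, h (x :* a) = h x :* a) -> right_linear h.
Proof. by move=> hD hR a x y; rewrite [LHS]hD; congr (_ + _); apply: hR. Qed.

Lemma rhom_ext (g h : rhom) : g =1 h -> g = h.
Proof. by move=> gh; apply: val_inj; apply: funext. Qed.

Fact rhom_scale_subproof (u : U) (h : rhom) :
  (fun x => u *: h x) \in right_linearb.
Proof.
apply/right_linearbP/right_linearP => [x y|x a]; first by rewrite rhomD scalerDr.
by rewrite rhomR scale_ract.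
Qed.
Definition rhom_scale u h : rhom := RHom (rhom_scale_subproof u h).

Fact rhom_ract_subproof (h : rhom) (t : T) :
  (fun x => h (t *: x)) \in right_linearb.
Proof.
apply/right_linearbP/right_linearP => [x y|x a]; first by rewrite scalerDr rhomD.
by rewrite scale_ract rhomR.
Qed.
Definition rhom_ract h t : rhom := RHom (rhom_ract_subproof h t).

Fact rhom_scaleA a b h : rhom_scale a (rhom_scale b h) = rhom_scale (a * b) h.
Proof. by apply: rhom_ext => x /=; rewrite scalerA. Qed.
Fact rhom_scale1 : left_id 1 rhom_scale.
Proof. by move=> h; apply: rhom_ext => x /=; rewrite scale1r. Qed.
Fact rhom_scaleDr : right_distributive rhom_scale +%R.
Proof. by move=> a g h; apply: rhom_ext => x /=; rewrite [LHS]scalerDr. Qed.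
Fact rhom_scaleDl h : {morph rhom_scale^~ h : a b / a + b}.
Proof. by move=> a b; apply: rhom_ext => x /=; rewrite [LHS]scalerDl. Qed.

HB.instance Definition _ := GRing.Zmodule_isLmodule.Build U rhom
  rhom_scaleA rhom_scale1 rhom_scaleDr rhom_scaleDl.

Fact rhom_ractDl a : {morph rhom_ract^~ a : g h / g + h}.
Proof. by move=> g h; apply: rhom_ext. Qed.
Fact rhom_ractDr h : {morph rhom_ract h : a b / a + b}.
Proof. by move=> a b; apply: rhom_ext => x /=; rewrite scalerDl rhomD. Qed.
Fact rhom_ractA h a b : rhom_ract (rhom_ract h a) b = rhom_ract h (a * b).
Proof. by apply: rhom_ext => x /=; rewrite scalerA. Qed.
Fact rhom_ract1 h : rhom_ract h 1 = h.
Proof. by apply: rhom_ext => x /=; rewrite scale1r. Qed.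
Fact rhom_scale_ract (u : U) h a : u *: rhom_ract h a = rhom_ract (u *: h) a.
Proof. exact: rhom_ext. Qed.

HB.instance Definition _ := Lmodule_isBimodule.Build U T rhom
  rhom_ractDl rhom_ractDr rhom_ractA rhom_ract1 rhom_scale_ract.

Lemma rhomZE (u : U) (h : rhom) x : (u *: h) x = u *: h x. Proof. by []. Qed.
Lemma rhomRE (h : rhom) (t : T) x : (h :* t) x = h (t *: x). Proof. by []. Qed.

End RHom.

Definition finitely_generated (S : pzRingType) (M : lmodType S) : Prop :=
  exists (n : nat) (v : 'I_n -> M),
    forall x, exists a : 'I_n -> S, x = \sum_i a i *: v i.

Definition projective (S : pzRingType) (M : lmodType S) : Prop :=
  forall (N N' : lmodType S) (p : {linear N -> N'}) (g : {linear M -> N'}),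
    (forall y, exists x, p x = y) ->
    exists h : {linear M -> N}, forall x, p (h x) = g x.

Section FrobeniusExtension.
Variables (R : pzRingType) (P : {pred R}) (S : subPzRingType P).

Definition ext_SS : bimodType S S :=
  ring_bimod (\val : {rmorphism S -> R}) (\val : {rmorphism S -> R}).
Definition ext_SR : bimodType S R :=
  ring_bimod (\val : {rmorphism S -> R}) (idfun : {rmorphism R -> R}).
Definition ext_RS : bimodType R S :=
  ring_bimod (idfun : {rmorphism R -> R}) (\val : {rmorphism S -> R}).

End FrobeniusExtension.

Definition twisted_bimod (S : pzRingType) (beta : {rmorphism S -> S}) :
  bimodType S S := ring_bimod (idfun : {rmorphism S -> S}) beta.

Definition beta_Frobenius_extension (R : pzRingType) (P : {pred R})
    (S : subPzRingType P) (beta : {rmorphism S -> S}) : Prop :=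
  [/\ finitely_generated (right_module (ext_RS S)),
      projective (right_module (ext_RS S)) &
      exists f : bimod_hom (ext_SR S) (rhom (ext_RS S) (twisted_bimod beta)),
        is_bimod_iso f].

Section Tensor.
Variables (S T U : pzRingType) (M : bimodType S T) (N : bimodType T U).

(* The subgroup of the free abelian group on M * N by which one divides to get
   the tensor product of M and N over T. *)
Inductive tensor_null : {freeg (M * N)%type} -> Prop :=
| TensorNull0 : tensor_null 0
| TensorNullB x y : tensor_null x -> tensor_null y -> tensor_null (x - y)
| TensorNullDl a a' b :
    tensor_null (<< (a + a', b) >> - (<< (a, b) >> + << (a', b) >>))
| TensorNullDr a b b' :
    tensor_null (<< (a, b + b') >> - (<< (a, b) >> + << (a, b') >>))
| TensorNullZ a t b :
    tensor_null (<< (a :* t, b) >> - << (a, t *: b) >>).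

Definition tensor_nullb : {pred {freeg (M * N)%type}} :=
  fun x => `[< tensor_null x >].

Fact tensor_null_zmod : zmod_closed tensor_nullb.
Proof.
split=> [|x y /asboolP xP /asboolP yP]; apply/asboolP; first exact: TensorNull0.
exact: TensorNullB.
Qed.

HB.instance Definition _ := GRing.isZmodClosed.Build {freeg (M * N)%type}
  tensor_nullb tensor_null_zmod.

Definition tensor : Type := Quotient.quot tensor_nullb.

HB.instance Definition _ := GRing.Zmodule.on tensor.

Definition tens (a : M) (b : N) : tensor :=
  \pi_(Quotient.quot tensor_nullb)%qT << (a, b) >>.


Local Notation Q := (Quotient.quot tensor_nullb).

Lemma pi_tensor_eq (x y : {freeg (M * N)%type}) :
  tensor_null (x - y) -> (\pi_Q x = \pi_Q y :> Q)%qT.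
Proof. by move=> xy; apply/eqP; rewrite -Quotient.idealrBE; apply/asboolP. Qed.

Lemma tensDl b : {morph tens^~ b : a a' / a + a'}.
Proof.
move=> a a'; rewrite /tens -[RHS]raddfD.
exact/pi_tensor_eq/TensorNullDl.
Qed.

Lemma tensDr a : {morph tens a : b b' / b + b'}.
Proof.
move=> b b'; rewrite /tens -[RHS]raddfD.
exact/pi_tensor_eq/TensorNullDr.
Qed.

Lemma tens_balanced a t b : tens (a :* t) b = tens a (t *: b).
Proof. exact/pi_tensor_eq/TensorNullZ. Qed.

Lemma tensor_ind (P : tensor -> Prop) :
  (forall a b, P (tens a b)) -> (forall x y, P x -> P y -> P (x - y)) ->
  forall t, P t.
Proof.
move=> Pt PB.
have P0 : P 0 by rewrite -(subrr (tens 0 0)); apply: PB.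
have PN x : P x -> P (- x) by rewrite -[- x]sub0r; apply: PB.
have PD x y : P x -> P y -> P (x + y).
  by move=> Px /PN Py; rewrite -[y]opprK; apply: PB.
have PZ x k : P x -> P (x *~ k).
  have Pn n : P x -> P (x *+ n).
    by move=> Px; elim: n => [|n IHn]; rewrite ?mulrS //; apply: PD.
  by case: k => n Px; rewrite ?NegzE ?mulrNz; [|apply: PN]; apply: Pn.
elim/quotW => D; rewrite -(freeg_sumE D).
rewrite [X in P X](raddf_sum (\pi_Q)%qT).
apply: (big_ind P) => // -[a b] _.
rewrite -[coeff _ _]intz -freegU_mulz [X in P X](raddfMz (\pi_Q)%qT).
exact: PZ (Pt a b).
Qed.

Definition balanced (G : zmodType) (f : M -> N -> G) : Prop :=
  [/\ forall b, {morph f^~ b : a a' / a + a'},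
      forall a, {morph f a : b b' / b + b'} &
      forall a t b, f (a :* t) b = f a (t *: b)].

Section Lift.
Variables (G : zmodType) (f : M -> N -> G) (fb : balanced f).

Let free_lift : {freeg (M * N)%type} -> G :=
  fglift (fun ab : (M * N)%type => f ab.1 ab.2 : zmodule G).

Let free_liftB : {morph free_lift : x y / x - y}.
Proof.
by move=> x y; apply: (lift_is_additive
  (fun ab : (M * N)%type => f ab.1 ab.2 : zmodule G) x y).
Qed.

Let free_liftU a b : free_lift << (a, b) >> = f a b.
Proof. by rewrite /free_lift liftU scale1r. Qed.

Let free_lift0 : free_lift 0 = 0.
Proof. by have := free_liftB 0 0; rewrite !subrr. Qed.

Let free_liftD : {morph free_lift : x y / x + y}.
Proof.
have fN x : free_lift (- x) = - free_lift x.
  by have := free_liftB 0 x; rewrite free_lift0 !sub0r.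
by move=> x y; rewrite -{1}[y]opprK free_liftB fN opprK.
Qed.

Let free_lift_null x : tensor_null x -> free_lift x = 0.
Proof.
case: fb => fDl fDr fZ.
elim=> [|y z _ yP _ zP|a a' b|a b b'|a t b].
- exact: free_lift0.
- by rewrite free_liftB yP zP subrr.
- by rewrite free_liftB free_liftD !free_liftU fDl subrr.
- by rewrite free_liftB free_liftD !free_liftU fDr subrr.
- by rewrite free_liftB !free_liftU fZ subrr.
Qed.

Definition tensor_lift of balanced f : tensor -> G := fun t => free_lift (repr t).

Let tensor_lift_pi x : tensor_lift fb (\pi_Q x)%qT = free_lift x.
Proof.
apply/eqP; rewrite -subr_eq0 -free_liftB; apply/eqP/free_lift_null/asboolP.
by rewrite -[asbool _]/(_ \in tensor_nullb) Quotient.idealrBE reprK.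
Qed.

Fact tensor_lift_zmod : zmod_morphism (tensor_lift fb).
Proof.
elim/quotW=> x; elim/quotW=> y.
rewrite -[X in tensor_lift fb X](raddfB (\pi_Q)%qT).
by rewrite !tensor_lift_pi free_liftB.
Qed.

HB.instance Definition _ := GRing.isZmodMorphism.Build tensor G
  (tensor_lift fb) tensor_lift_zmod.

Lemma tensor_liftE a b : tensor_lift fb (tens a b) = f a b.
Proof. by rewrite tensor_lift_pi free_liftU. Qed.

End Lift.

End Tensor.

Section BimodHomBuild.
Variables (S T : pzRingType) (M N : bimodType S T).

Lemma ract0l (a : T) : (0 : M) :* a = 0.
Proof. by apply: (addIr (0 :* a)); rewrite -ractDl !add0r. Qed.

Lemma ractNl (x : M) (a : T) : (- x) :* a = - (x :* a).
Proof. by apply: (addIr (x :* a)); rewrite -ractDl !addNr ract0l. Qed.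

Lemma ractBl (x y : M) (a : T) : (x - y) :* a = x :* a - y :* a.
Proof. by rewrite ractDl ractNl. Qed.

Lemma bimod_hom_ext (f g : bimod_hom M N) : f =1 g -> f = g.
Proof.
case: f g => [f fR] [g gR] /= fg.
have {}fg : f = g.
  case: f g fg {fR gR} => [f [[fa] [fm]]] [g [[ga] [gm]]] /= /funext fg.
  by subst g; rewrite (Prop_irrelevance fa ga) (Prop_irrelevance fm gm).
by subst g; rewrite (Prop_irrelevance fR gR).
Qed.

Variables (f : M -> N) (fB : zmod_morphism f) (fZ : scalable f).

Definition build_linear : {linear M -> N} :=
  HB.pack f (GRing.isZmodMorphism.Build M N f fB)
            (GRing.isScalable.Build S M N *:%R f fZ).

Definition build_hom (fR : forall x a, f (x :* a) = f x :* a) :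
  bimod_hom M N := @BimodHom _ _ _ _ build_linear fR.

End BimodHomBuild.

Section TensorBimod.
Variables (S T U : pzRingType) (M : bimodType S T) (N : bimodType T U).
Local Notation MN := (tensor M N).

Fact tens_scale_balanced (s : S) :
  balanced (fun (a : M) (b : N) => tens (s *: a) b).
Proof.
split=> [b a a'|a b b'|a t b] /=; rewrite ?scalerDr ?tensDl ?tensDr //.
by rewrite scale_ract tens_balanced.
Qed.

Fact tens_ract_balanced (u : U) :
  balanced (fun (a : M) (b : N) => tens a (b :* u)).
Proof.
split=> [b a a'|a b b'|a t b] /=; rewrite ?ractDl ?tensDl ?tensDr //.
by rewrite tens_balanced scale_ract.
Qed.

Definition tensor_scale s : MN -> MN := tensor_lift (tens_scale_balanced s).
Definition tensor_ract (t : MN) u : MN := tensor_lift (tens_ract_balanced u) t.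

Lemma tensor_eq (G : zmodType) (f g : MN -> G) :
  zmod_morphism f -> zmod_morphism g ->
  (forall a b, f (tens a b) = g (tens a b)) -> f =1 g.
Proof.
by move=> fB gB fg; elim/tensor_ind=> // x y; rewrite fB gB => -> ->.
Qed.

Let tensor_scaleB s : {morph tensor_scale s : x y / x - y}.
Proof. by move=> x y; apply: raddfB. Qed.
Fact tensor_scaleA a b t :
  tensor_scale a (tensor_scale b t) = tensor_scale (a * b) t.
Proof.
elim/tensor_ind: t => [m n|x y IHx IHy]; last by rewrite !tensor_scaleB IHx IHy.
by rewrite /tensor_scale !tensor_liftE scalerA.
Qed.
Fact tensor_scale1 : left_id 1 tensor_scale.
Proof.
elim/tensor_ind => [m n|x y IHx IHy]; last by rewrite tensor_scaleB IHx IHy.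
by rewrite /tensor_scale tensor_liftE scale1r.
Qed.
Fact tensor_scaleDr : right_distributive tensor_scale +%R.
Proof. by move=> a x y; apply: raddfD. Qed.
Fact tensor_scaleDl t : {morph tensor_scale^~ t : a b / a + b}.
Proof.
move=> a b; elim/tensor_ind: t => [m n|x y IHx IHy].
  by rewrite /tensor_scale !tensor_liftE scalerDl tensDl.
by rewrite !tensor_scaleB IHx IHy opprD addrACA.
Qed.

HB.instance Definition _ := GRing.Zmodule_isLmodule.Build S MN
  tensor_scaleA tensor_scale1 tensor_scaleDr tensor_scaleDl.

Fact tensor_ractDl a : {morph tensor_ract^~ a : x y / x + y}.
Proof. by move=> x y; apply: raddfD. Qed.
Let tensor_ractB a : {morph tensor_ract^~ a : x y / x - y}.
Proof. by move=> x y; apply: raddfB. Qed.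
Fact tensor_ractDr t : {morph tensor_ract t : a b / a + b}.
Proof.
move=> a b; elim/tensor_ind: t => [m n|x y IHx IHy].
  by rewrite /tensor_ract !tensor_liftE ractDr tensDr.
by rewrite !tensor_ractB IHx IHy opprD addrACA.
Qed.
Fact tensor_ractA t a b : tensor_ract (tensor_ract t a) b = tensor_ract t (a * b).
Proof.
elim/tensor_ind: t => [m n|x y IHx IHy]; last by rewrite !tensor_ractB IHx IHy.
by rewrite /tensor_ract !tensor_liftE ractA.
Qed.
Fact tensor_ract1 t : tensor_ract t 1 = t.
Proof.
elim/tensor_ind: t => [m n|x y IHx IHy]; last by rewrite !tensor_ractB IHx IHy.
by rewrite /tensor_ract tensor_liftE ract1.
Qed.
Fact tensor_scale_ract (s : S) t a :
  s *: tensor_ract t a = tensor_ract (s *: t) a.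
Proof.
elim/tensor_ind: t => [m n|x y IHx IHy].
  by rewrite /tensor_ract /GRing.scale /= /tensor_scale !tensor_liftE.
by rewrite scalerBr !tensor_ractB scalerBr IHx IHy.
Qed.

HB.instance Definition _ := Lmodule_isBimodule.Build S U MN
  tensor_ractDl tensor_ractDr tensor_ractA tensor_ract1 tensor_scale_ract.

Lemma tensZ (s : S) (a : M) (b : N) : s *: tens a b = tens (s *: a) b.
Proof. exact: tensor_liftE. Qed.

Lemma tensR (a : M) (b : N) (u : U) : tens a b :* u = tens a (b :* u).
Proof. exact: tensor_liftE. Qed.

Variables (K : bimodType S U) (f : M -> N -> K) (fb : balanced f).
Hypothesis fZ : forall s a b, f (s *: a) b = s *: f a b.
Hypothesis fR : forall a b u, f a (b :* u) = f a b :* u.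

Fact tensor_lift_scalable : scalable (tensor_lift fb).
Proof.
move=> s; elim/tensor_ind=> [a b|x y IHx IHy]; last first.
  by rewrite scalerBr !(tensor_lift_zmod fb) IHx IHy scalerBr.
by rewrite tensZ !tensor_liftE fZ.
Qed.

Fact tensor_lift_ract x u : tensor_lift fb (x :* u) = tensor_lift fb x :* u.
Proof.
elim/tensor_ind: x => [a b|x y IHx IHy]; last first.
  by rewrite ractBl !(tensor_lift_zmod fb) IHx IHy ractBl.
by rewrite tensR !tensor_liftE fR.
Qed.

Definition tensor_lift_hom : bimod_hom MN K :=
  build_hom (tensor_lift_zmod fb) tensor_lift_scalable tensor_lift_ract.

Lemma tensor_lift_homE a b : tensor_lift_hom (tens a b) = f a b.
Proof. exact: tensor_liftE. Qed.

End TensorBimod.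

Record monoidal_category := MonoidalCategory {
  obj :> Type;
  mor : obj -> obj -> Type;
  idm : forall A, mor A A;
  mcomp : forall A B C, mor B C -> mor A B -> mor A C;
  compA : forall A B C D (h : mor C D) (g : mor B C) (f : mor A B),
    mcomp h (mcomp g f) = mcomp (mcomp h g) f;
  comp1m : forall A B (f : mor A B), mcomp (idm B) f = f;
  compm1 : forall A B (f : mor A B), mcomp f (idm A) = f;

  tensO : obj -> obj -> obj;
  tensM : forall A A' B B', mor A A' -> mor B B' -> mor (tensO A B) (tensO A' B');
  tensM1 : forall A B, tensM (idm A) (idm B) = idm (tensO A B);
  tensM_comp : forall A A' A'' B B' B''
      (f' : mor A' A'') (f : mor A A') (g' : mor B' B'') (g : mor B B'),
    tensM (mcomp f' f) (mcomp g' g) = mcomp (tensM f' g') (tensM f g);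

  unitO : obj;

  assoc : forall A B C, mor (tensO (tensO A B) C) (tensO A (tensO B C));
  assocV : forall A B C, mor (tensO A (tensO B C)) (tensO (tensO A B) C);
  assocK : forall A B C, mcomp (assocV A B C) (assoc A B C) = idm _;
  assocVK : forall A B C, mcomp (assoc A B C) (assocV A B C) = idm _;
  assoc_nat : forall A A' B B' C C'
      (f : mor A A') (g : mor B B') (h : mor C C'),
    mcomp (assoc A' B' C') (tensM (tensM f g) h) =
    mcomp (tensM f (tensM g h)) (assoc A B C);

  lunit : forall A, mor (tensO unitO A) A;
  lunitV : forall A, mor A (tensO unitO A);
  lunitK : forall A, mcomp (lunitV A) (lunit A) = idm _;
  lunitVK : forall A, mcomp (lunit A) (lunitV A) = idm _;
  lunit_nat : forall A A' (f : mor A A'),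
    mcomp (lunit A') (tensM (idm unitO) f) = mcomp f (lunit A);

  runit : forall A, mor (tensO A unitO) A;
  runitV : forall A, mor A (tensO A unitO);
  runitK : forall A, mcomp (runitV A) (runit A) = idm _;
  runitVK : forall A, mcomp (runit A) (runitV A) = idm _;
  runit_nat : forall A A' (f : mor A A'),
    mcomp (runit A') (tensM f (idm unitO)) = mcomp f (runit A);

  triangle : forall A B,
    mcomp (tensM (idm A) (lunit B)) (assoc A unitO B) = tensM (runit A) (idm B);
  pentagon : forall A B C D,
    mcomp (assoc A B (tensO C D)) (assoc (tensO A B) C D) =
    mcomp (tensM (idm A) (assoc B C D))
      (mcomp (assoc A (tensO B C) D) (tensM (assoc A B C) (idm D)))
}.

Arguments mor {m}.
Arguments idm {m}.
Arguments mcomp {m A B C}.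
Arguments tensO {m}.
Arguments tensM {m A A' B B'}.
Arguments unitO {m}.
Arguments assoc {m}.
Arguments assocV {m}.
Arguments lunit {m}.
Arguments lunitV {m}.
Arguments runit {m}.
Arguments runitV {m}.

Declare Scope mcat_scope.
Delimit Scope mcat_scope with mcat.
Local Open Scope mcat_scope.

Notation "g \c f" := (mcomp g f) (at level 50, left associativity) : mcat_scope.
Notation "A \ox B" := (tensO A B) (at level 40, left associativity) : mcat_scope.
Notation "f \om g" := (tensM f g) (at level 40, left associativity) : mcat_scope.

Section Frobenius.
Variable C : monoidal_category.

Definition is_iso (A B : C) (f : mor A B) : Prop :=
  exists g : mor B A, g \c f = idm A /\ f \c g = idm B.

Record algebra := Algebra {
  alg_obj :> C;
  alg_mul : mor (alg_obj \ox alg_obj) alg_obj;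
  alg_unit : mor unitO alg_obj;
  alg_mulA : alg_mul \c (alg_mul \om idm alg_obj) =
    alg_mul \c (idm alg_obj \om alg_mul) \c assoc alg_obj alg_obj alg_obj;
  alg_mul1m : alg_mul \c (alg_unit \om idm alg_obj) = lunit alg_obj;
  alg_mulm1 : alg_mul \c (idm alg_obj \om alg_unit) = runit alg_obj
}.

Record left_dual (A : C) := LeftDual {
  dualO :> C;
  ev : mor (dualO \ox A) unitO;
  coev : mor unitO (A \ox dualO);
  ev_coev : runit A \c (idm A \om ev) \c assoc A dualO A
      \c (coev \om idm A) \c lunitV A = idm A;
  coev_ev : lunit dualO \c (ev \om idm dualO) \c assocV dualO A dualO
      \c (idm dualO \om coev) \c runitV dualO = idm dualO
}.

Definition Frobenius_map (A : algebra) (D : left_dual A) (W : C) (n : mor A W) :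
    mor A (W \ox D) :=
  let kappa := n \c alg_mul A in
  (kappa \om idm (D : C)) \c assocV (A : C) A D
    \c (idm (A : C) \om coev D) \c runitV (A : C).

(* "A is left dualizable and (W, n) makes the Frobenius map invertible"; the
   choice of left dual is immaterial, as left duals are unique up to
   isomorphism. *)
Definition Frobenius_structure (A : algebra) (W : C) (n : mor A W) : Prop :=
  exists D : left_dual A, is_iso (Frobenius_map D n).

End Frobenius.

Section BimodMaps.
Variables (S T : pzRingType).

Definition bimod_id (M : bimodType S T) : bimod_hom M M :=
  @BimodHom _ _ _ _ (idfun : {linear M -> M}) (fun _ _ => erefl).

Fact bimod_comp_subproof (M N K : bimodType S T) (g : bimod_hom N K)
  (f : bimod_hom M N) x a : (g \o f) (x :* a) = (g \o f) x :* a.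
Proof. by rewrite /= !bimod_funR. Qed.

Definition bimod_comp (M N K : bimodType S T) (g : bimod_hom N K)
    (f : bimod_hom M N) : bimod_hom M K :=
  @BimodHom _ _ _ _ (g \o f : {linear M -> K}) (bimod_comp_subproof g f).

Lemma bimod_idE (M : bimodType S T) x : bimod_id M x = x.
Proof. by []. Qed.
Lemma bimod_compE (M N K : bimodType S T) (g : bimod_hom N K)
  (f : bimod_hom M N) x : bimod_comp g f x = g (f x).
Proof. by []. Qed.

End BimodMaps.

Section TensorHom.
Variables (S T U : pzRingType) (M M' : bimodType S T) (N N' : bimodType T U).
Variables (f : bimod_hom M M') (g : bimod_hom N N').

Fact tensor_hom_balanced : balanced (fun (a : M) (b : N) => tens (f a) (g b)).
Proof.
split=> [b a a'|a b b'|a t b] /=; rewrite ?linearD ?tensDl ?tensDr //.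
by rewrite bimod_funR tens_balanced linearZ.
Qed.

Fact tensor_hom_scale s (a : M) (b : N) :
  tens (f (s *: a)) (g b) = s *: tens (f a) (g b).
Proof. by rewrite linearZ tensZ. Qed.

Fact tensor_hom_ract (a : M) (b : N) u :
  tens (f a) (g (b :* u)) = tens (f a) (g b) :* u.
Proof. by rewrite bimod_funR tensR. Qed.

Definition tensor_hom : bimod_hom (tensor M N) (tensor M' N') :=
  tensor_lift_hom tensor_hom_balanced tensor_hom_scale tensor_hom_ract.

Lemma tensor_homE a b : tensor_hom (tens a b) = tens (f a) (g b).
Proof. exact: tensor_liftE. Qed.

End TensorHom.

Section TensTheory.
Variables (S T U : pzRingType) (M : bimodType S T) (N : bimodType T U).

Lemma tens0l (b : N) : tens (0 : M) b = 0.
Proof. by apply: (addIr (tens 0 b)); rewrite -tensDl !add0r. Qed.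
Lemma tens0r (a : M) : tens a (0 : N) = 0.
Proof. by apply: (addIr (tens a 0)); rewrite -tensDr !add0r. Qed.
Lemma tensBl (b : N) : {morph (fun a : M => tens a b) : a a' / a - a'}.
Proof. by move=> a a'; apply: (addIr (tens a' b)); rewrite -tensDl !subrK. Qed.
Lemma tensBr (a : M) : {morph (fun b : N => tens a b) : b b' / b - b'}.
Proof. by move=> b b'; apply: (addIr (tens a b')); rewrite -tensDr !subrK. Qed.

End TensTheory.

Section TensorAssoc.
Variables (S T U V : pzRingType).
Variables (M : bimodType S T) (N : bimodType T U) (K : bimodType U V).

Fact assoc_balanced1 (c : K) :
  balanced (fun (a : M) (b : N) => tens a (tens b c)).
Proof.
split=> [b a a'|a b b'|a t b] /=; rewrite ?tensDl ?tensDr //.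
by rewrite tens_balanced tensZ.
Qed.

Definition assoc1 (x : tensor M N) (c : K) : tensor M (tensor N K) :=
  tensor_lift (assoc_balanced1 c) x.

Lemma assoc1B (c : K) : {morph assoc1^~ c : x y / x - y}.
Proof. exact: tensor_lift_zmod. Qed.
Lemma assoc1E a b c : assoc1 (tens a b) c = tens a (tens b c).
Proof. exact: tensor_liftE. Qed.

Fact assoc_balanced : balanced assoc1.
Proof.
split=> [c x y|x c c'|x u c].
- exact: raddfD.
- elim/tensor_ind: x => [a b|x y IHx IHy]; first by rewrite !assoc1E !tensDr.
  by rewrite !assoc1B IHx IHy opprD addrACA.
- elim/tensor_ind: x => [a b|x y IHx IHy].
    by rewrite tensR !assoc1E tens_balanced.
  by rewrite ractBl !assoc1B IHx IHy.
Qed.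

Fact assoc1Z s x c : assoc1 (s *: x) c = s *: assoc1 x c.
Proof.
elim/tensor_ind: x => [a b|x y IHx IHy]; first by rewrite tensZ !assoc1E tensZ.
by rewrite scalerBr !assoc1B scalerBr IHx IHy.
Qed.

Fact assoc1R x c v : assoc1 x (c :* v) = assoc1 x c :* v.
Proof.
elim/tensor_ind: x => [a b|x y IHx IHy].
  by rewrite !assoc1E tensR -tensR.
by rewrite !assoc1B ractBl IHx IHy.
Qed.

Definition tensor_assoc :
    bimod_hom (tensor (tensor M N) K) (tensor M (tensor N K)) :=
  tensor_lift_hom assoc_balanced assoc1Z assoc1R.

Lemma tensor_assocE a b c :
  tensor_assoc (tens (tens a b) c) = tens a (tens b c).
Proof. by rewrite [LHS]tensor_liftE assoc1E. Qed.

Fact assocV_balanced1 (a : M) :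
  balanced (fun (b : N) (c : K) => tens (tens a b) c).
Proof.
split=> [c b b'|b c c'|b t c] /=; rewrite ?tensDr ?tensDl //.
by rewrite -tensR tens_balanced.
Qed.

Definition assocV1 (a : M) (x : tensor N K) : tensor (tensor M N) K :=
  tensor_lift (assocV_balanced1 a) x.

Lemma assocV1B (a : M) : {morph assocV1 a : x y / x - y}.
Proof. exact: tensor_lift_zmod. Qed.
Lemma assocV1E a b c : assocV1 a (tens b c) = tens (tens a b) c.
Proof. exact: tensor_liftE. Qed.

Fact assocV_balanced : balanced assocV1.
Proof.
split=> [x a a'|a x y|a t x].
- elim/tensor_ind: x => [b c|x y IHx IHy]; first by rewrite !assocV1E !tensDl.
  by rewrite !assocV1B IHx IHy opprD addrACA.
- exact: raddfD.
- elim/tensor_ind: x => [b c|x y IHx IHy].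
    by rewrite tensZ !assocV1E tens_balanced.
  by rewrite scalerBr !assocV1B IHx IHy.
Qed.

Fact assocV1Z s a x : assocV1 (s *: a) x = s *: assocV1 a x.
Proof.
elim/tensor_ind: x => [b c|x y IHx IHy]; first by rewrite !assocV1E !tensZ.
by rewrite !assocV1B scalerBr IHx IHy.
Qed.

Fact assocV1R a x v : assocV1 a (x :* v) = assocV1 a x :* v.
Proof.
elim/tensor_ind: x => [b c|x y IHx IHy].
  by rewrite tensR !assocV1E tensR.
by rewrite ractBl !assocV1B ractBl IHx IHy.
Qed.

Definition tensor_assocV :
    bimod_hom (tensor M (tensor N K)) (tensor (tensor M N) K) :=
  tensor_lift_hom assocV_balanced assocV1Z assocV1R.

Lemma tensor_assocVE a b c :
  tensor_assocV (tens a (tens b c)) = tens (tens a b) c.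
Proof. by rewrite [LHS]tensor_liftE assocV1E. Qed.

End TensorAssoc.

Definition unit_bimod (S : pzRingType) : bimodType S S :=
  ring_bimod (idfun : {rmorphism S -> S}) (idfun : {rmorphism S -> S}).

Section TensorUnit.
Variables (S T : pzRingType) (M : bimodType S T).

Fact lunit_balanced : balanced (fun (s : unit_bimod S) (a : M) => (s : S) *: a).
Proof.
split=> [a s s'|s a a'|s t a] /=; [exact: scalerDl | exact: scalerDr |].
by rewrite scalerA.
Qed.
Fact lunit_scale s (t : unit_bimod S) (a : M) :
  ((s *: t : unit_bimod S) : S) *: a = s *: ((t : S) *: a).
Proof. by rewrite scalerA. Qed.
Fact lunit_ract (s : unit_bimod S) (a : M) u :
  (s : S) *: (a :* u) = ((s : S) *: a) :* u.
Proof. exact: scale_ract. Qed.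

Definition tensor_lunit : bimod_hom (tensor (unit_bimod S) M) M :=
  tensor_lift_hom lunit_balanced lunit_scale lunit_ract.

Lemma tensor_lunitE (s : unit_bimod S) a : tensor_lunit (tens s a) = (s : S) *: a.
Proof. exact: tensor_liftE. Qed.

Let lunitV_fun (a : M) := tens (1 : unit_bimod S) a.
Fact lunitV_zmod : zmod_morphism lunitV_fun. Proof. exact: tensBr. Qed.
Fact lunitV_scale : scalable lunitV_fun.
Proof. by move=> s a; rewrite /lunitV_fun tensZ -tens_balanced rbRE rbZE mul1r mulr1. Qed.
Fact lunitV_ract a u : lunitV_fun (a :* u) = lunitV_fun a :* u.
Proof. by rewrite [RHS]tensR. Qed.

Definition tensor_lunitV : bimod_hom M (tensor (unit_bimod S) M) :=
  build_hom lunitV_zmod lunitV_scale lunitV_ract.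

Lemma tensor_lunitVE a : tensor_lunitV a = tens (1 : unit_bimod S) a.
Proof. by []. Qed.

Fact runit_balanced : balanced (fun (a : M) (t : unit_bimod T) => a :* (t : T)).
Proof.
split=> [t a a'|a t t'|a t u] /=; [exact: ractDl | exact: ractDr |].
by rewrite ractA.
Qed.
Fact runit_scale s (a : M) (t : unit_bimod T) :
  (s *: a) :* (t : T) = s *: (a :* (t : T)).
Proof. by rewrite scale_ract. Qed.
Fact runit_ract (a : M) (t : unit_bimod T) u :
  a :* ((t :* u : unit_bimod T) : T) = (a :* (t : T)) :* u.
Proof. by rewrite ractA. Qed.

Definition tensor_runit : bimod_hom (tensor M (unit_bimod T)) M :=
  tensor_lift_hom runit_balanced runit_scale runit_ract.

Lemma tensor_runitE a (t : unit_bimod T) : tensor_runit (tens a t) = a :* (t : T).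
Proof. exact: tensor_liftE. Qed.

Let runitV_fun (a : M) := tens a (1 : unit_bimod T).
Fact runitV_zmod : zmod_morphism runitV_fun. Proof. exact: tensBl. Qed.
Fact runitV_scale : scalable runitV_fun.
Proof. by move=> s a; rewrite /runitV_fun tensZ. Qed.
Fact runitV_ract a u : runitV_fun (a :* u) = runitV_fun a :* u.
Proof. by rewrite /runitV_fun tensR tens_balanced rbRE rbZE mul1r mulr1. Qed.

Definition tensor_runitV : bimod_hom M (tensor M (unit_bimod T)) :=
  build_hom runitV_zmod runitV_scale runitV_ract.

Lemma tensor_runitVE a : tensor_runitV a = tens a (1 : unit_bimod T).
Proof. by []. Qed.

End TensorUnit.

Lemma tensor_hom_eq (S T U : pzRingType) (M : bimodType S T) (N : bimodType T U)
  (K : bimodType S U) (f g : bimod_hom (tensor M N) K) :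
  (forall a b, f (tens a b) = g (tens a b)) -> f = g.
Proof.
by move=> fg; apply/bimod_hom_ext/tensor_eq => // x y; apply: linearB.
Qed.

Lemma tensor_hom_eql (S T U V : pzRingType)
  (M : bimodType S T) (N : bimodType T U) (K : bimodType U V) (L : bimodType S V)
  (f g : bimod_hom (tensor (tensor M N) K) L) :
  (forall a b c, f (tens (tens a b) c) = g (tens (tens a b) c)) -> f = g.
Proof.
move=> fg; apply: tensor_hom_eq => x c; elim/tensor_ind: x => // x y IHx IHy.
by rewrite tensBl !linearB /= IHx IHy.
Qed.

Lemma tensor_hom_eqr (S T U V : pzRingType)
  (M : bimodType S T) (N : bimodType T U) (K : bimodType U V) (L : bimodType S V)
  (f g : bimod_hom (tensor M (tensor N K)) L) :
  (forall a b c, f (tens a (tens b c)) = g (tens a (tens b c))) -> f = g.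
Proof.
move=> fg; apply: tensor_hom_eq => a x; elim/tensor_ind: x => // x y IHx IHy.
by rewrite tensBr !linearB /= IHx IHy.
Qed.

Lemma tensor_hom_eqll (S T U V X : pzRingType)
  (M : bimodType S T) (N : bimodType T U) (K : bimodType U V) (L : bimodType V X)
  (P : bimodType S X) (f g : bimod_hom (tensor (tensor (tensor M N) K) L) P) :
  (forall a b c d, f (tens (tens (tens a b) c) d) = g (tens (tens (tens a b) c) d)) ->
  f = g.
Proof.
move=> fg; apply: tensor_hom_eql => x c d.
elim/tensor_ind: x => // x y IHx IHy.
by rewrite !tensBl !linearB /= IHx IHy.
Qed.

Section BimodCategory.
Variable S : pzRingType.

Local Ltac chase := rewrite ?(bimod_compE, bimod_idE, tensor_homE,
  tensor_assocE, tensor_assocVE, tensor_lunitE, tensor_runitE,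
  tensor_lunitVE, tensor_runitVE).

Definition bimod_category : monoidal_category.
Proof.
refine (@MonoidalCategory (bimodType S S) (@bimod_hom S S)
  (@bimod_id S S) (@bimod_comp S S) _ _ _
  (@tensor S S S) (@tensor_hom S S S) _ _ (unit_bimod S)
  (@tensor_assoc S S S S) (@tensor_assocV S S S S) _ _ _
  (@tensor_lunit S S) (@tensor_lunitV S S) _ _ _
  (@tensor_runit S S) (@tensor_runitV S S) _ _ _ _ _).
- abstract by move=> *; apply: bimod_hom_ext.
- abstract by move=> *; apply: bimod_hom_ext.
- abstract by move=> *; apply: bimod_hom_ext.
- abstract by move=> A B; apply: tensor_hom_eq => a b; chase.
- abstract by move=> *; apply: tensor_hom_eq => a b; chase.
- abstract by move=> *; apply: tensor_hom_eql => a b c; chase.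
- abstract by move=> *; apply: tensor_hom_eqr => a b c; chase.
- abstract by move=> *; apply: tensor_hom_eql => a b c; chase.
- abstract by move=> A; apply: tensor_hom_eq => s a; chase;
    rewrite -tens_balanced rbRE mul1r.
- abstract by move=> A; apply: bimod_hom_ext => a; chase; rewrite scale1r.
- abstract by move=> *; apply: tensor_hom_eq => s a; chase; rewrite linearZ.
- abstract by move=> A; apply: tensor_hom_eq => a s; chase;
    rewrite tens_balanced rbZE mulr1.
- abstract by move=> A; apply: bimod_hom_ext => a; chase; rewrite ract1.
- abstract by move=> *; apply: tensor_hom_eq => a s; chase; rewrite bimod_funR.
- abstract by move=> A B; apply: tensor_hom_eql => a s b; chase;
    rewrite tens_balanced.
- abstract by move=> *; apply: tensor_hom_eqll => a b c d;
    rewrite !bimod_compE tensor_homE !tensor_assocE tensor_homE !tensor_assocE.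
Defined.

End BimodCategory.

Section ExtensionAlgebra.
Variables (R : pzRingType) (P : {pred R}) (S : subPzRingType P).
Local Notation A := (ext_SS S).

Fact ext_mul_balanced : balanced (fun a b : A => (a : R) * b : A).
Proof.
split=> [b a a'|a b b'|a t b] /=; [exact: mulrDl | exact: mulrDr |].
by rewrite rbRE rbZE mulrA.
Qed.
Fact ext_mul_scale (s : S) (a b : A) :
  ((s *: a : A) : R) * b = s *: ((a : R) * b : A) :> A.
Proof. by rewrite !rbZE mulrA. Qed.
Fact ext_mul_ract (a b : A) (s : S) :
  (a : R) * (b :* s : A) = ((a : R) * b : A) :* s :> A.
Proof. by rewrite !rbRE mulrA. Qed.

Definition ext_mul : bimod_hom (tensor A A) A :=
  tensor_lift_hom ext_mul_balanced ext_mul_scale ext_mul_ract.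

Lemma ext_mulE (a b : A) : ext_mul (tens a b) = (a : R) * b.
Proof. exact: tensor_liftE. Qed.

Let ext_incl (s : unit_bimod S) : A := \val (s : S).
Fact ext_incl_zmod : zmod_morphism ext_incl.
Proof. exact: (raddfB (\val : {rmorphism S -> R})). Qed.
Fact ext_incl_scale : scalable ext_incl.
Proof. exact: (rmorphM (\val : {rmorphism S -> R})). Qed.
Fact ext_incl_ract s t : ext_incl (s :* t) = ext_incl s :* t.
Proof. exact: (rmorphM (\val : {rmorphism S -> R})). Qed.

Definition ext_unit : bimod_hom (unit_bimod S) A :=
  build_hom ext_incl_zmod ext_incl_scale ext_incl_ract.

Fact ext_mulA : bimod_comp ext_mul (tensor_hom ext_mul (bimod_id A)) =
  bimod_comp (bimod_comp ext_mul (tensor_hom (bimod_id A) ext_mul))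
    (tensor_assoc A A A).
Proof.
apply: tensor_hom_eql => a b c; rewrite !bimod_compE tensor_assocE.
by rewrite !tensor_homE !bimod_idE !ext_mulE mulrA.
Qed.

Fact ext_mul1m :
  bimod_comp ext_mul (tensor_hom ext_unit (bimod_id A)) = tensor_lunit A.
Proof.
apply: tensor_hom_eq => s a.
by rewrite bimod_compE tensor_homE ext_mulE tensor_lunitE.
Qed.

Fact ext_mulm1 :
  bimod_comp ext_mul (tensor_hom (bimod_id A) ext_unit) = tensor_runit A.
Proof.
apply: tensor_hom_eq => a s.
by rewrite bimod_compE tensor_homE ext_mulE tensor_runitE.
Qed.

Definition ext_algebra : algebra (bimod_category S) :=
  @Algebra (bimod_category S) A ext_mul ext_unit ext_mulA ext_mul1m ext_mulm1.

End ExtensionAlgebra.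

(* Main.v *)
Require Import Defs.
From HB Require Import structures.
From mathcomp Require Import all_boot all_algebra.
From mathcomp Require Import boolp.

Set Implicit Arguments.
Unset Strict Implicit.
Unset Printing Implicit Defensive.

Import GRing.Theory.

Local Open Scope ring_scope.

(** Write A for R as an S-S-bimodule.  The point is that both notions ask for
    one and the same map to be bijective.

    If D is a left dual of an S-S-bimodule M, with evaluation e and coevaluation
    c, then for every S-S-bimodule N the tensor product of N and D is the group
    of right S-linear maps M -> N.  A tensor b ⊗ d acts as
    x |-> b e(d ⊗ x), and a map h comes from the tensor (h ⊗ 1)(c 1)
    ([rhom_to_tensorK], [tensor_to_rhomK]); the two triangle identities say
    exactly that these assignments are mutually inverse.  Take M = A, and let
    n : A -> N be a map of bimodules.  The Frobenius map of n sends r to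
    (n(r -) ⊗ 1)(c 1), so under this identification it becomes
    r |-> n(r -) ([Frobenius_mapE]), and one of the two maps is invertible if
    and only if the other is ([Frobenius_map_iso]).

    For N the twisted bimodule, r |-> n(r -) is the general form of an
    S-R-bimodule map f from R to the right S-linear maps R -> N: right
    R-linearity forces f(r) = f(1)(r -), and the remaining linearity of f and of
    its values says that n = f(1) is a map of S-S-bimodules
    ([translate_hom_value1]).

    Finally, A has a left dual if and only if R is finitely generated and
    projective as a right S-module, since both conditions amount to a finite
    dual basis, x = \sum_i v_i c_i(x).  Writing c 1 as a sum of pure tensors
    a_i ⊗ d_i turns the first triangle identity into such an expansion with
    coordinates e(d_i ⊗ -) ([left_dual_fg_projective]); conversely, given a
    dual basis, the right S-linear maps A -> S form a left dual with
    coevaluation s |-> s \sum_i v_i ⊗ c_i ([fg_projective_left_dual]). *)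

(** * Dual bases of finitely generated projective modules *)

Definition linear_of (K : pzRingType) (V W : lmodType K) (f : V -> W)
    (fB : zmod_morphism f) (fZ : scalable f) : {linear V -> W} :=
  HB.pack f (GRing.isZmodMorphism.Build V W f fB)
    (GRing.isScalable.Build K V W *:%R f fZ).

Section DualBasis.
Variables (K : pzRingType) (V : lmodType K).

(** A map out of V lifts along a surjection once its values at the finitely many
    v_i are lifted: the coordinates spread the chosen lifts over all of V. *)
Lemma dual_basis_projective n (v : 'I_n -> V) (c : 'I_n -> {linear V -> K^o}) :
  (forall x, x = \sum_i (c i x : K) *: v i) -> projective V.
Proof.
move=> vc N N' p g p_surj; have [q qK] := choice p_surj.
pose h (x : V) : N := \sum_i c i x *: q (g (v i)).
have hB : zmod_morphism h.
  move=> x y; rewrite -sumrB; apply: eq_bigr => i _.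
  by rewrite linearB; apply: scalerBl.
have hZ : scalable h.
  move=> a x; rewrite scaler_sumr; apply: eq_bigr => i _.
  by rewrite linearZ scalerA.
exists (linear_of hB hZ) => x /=.
rewrite [in RHS](vc x) !linear_sum; apply: eq_bigr => i _.
by rewrite !linearZ qK.
Qed.

(** Generators v_i present V as a quotient of a free module; projectivity splits
    the quotient map, and the entries of the section are the coordinates. *)
Lemma fg_projective_dual_basis : finitely_generated V -> projective V ->
  exists n (v : 'I_n -> V) (c : 'I_n -> {linear V -> K^o}),
    forall x, x = \sum_i (c i x : K) *: v i.
Proof.
move=> [n [v v_gen]] V_proj.
pose comb (u : 'rV[K]_n) : V := \sum_i u 0 i *: v i.
have combB : zmod_morphism comb.
  by move=> x y; rewrite -sumrB; apply: eq_bigr => i _; rewrite !mxE scalerBl.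
have combZ : scalable comb.
  move=> a x; rewrite scaler_sumr; apply: eq_bigr => i _.
  by rewrite mxE scalerA.
have comb_surj y : exists u, linear_of combB combZ u = y.
  have [a ->] := v_gen y; exists (\row_i a i).
  by apply: eq_bigr => i _; rewrite mxE.
have [h hK] := V_proj _ _ _ idfun comb_surj.
pose coord i (x : V) : K^o := h x 0 i.
have coordB i : zmod_morphism (coord i).
  by move=> x y; rewrite /coord linearB !mxE.
have coordZ i : scalable (coord i).
  by move=> a x; rewrite /coord linearZ mxE.
exists n, v, (fun i => linear_of (coordB i) (coordZ i)) => x.
by rewrite -[LHS](hK x).
Qed.

End DualBasis.

(** * Bimodules and tensors *)

Section Bimodules.
Variables (S T U : pzRingType).

Lemma cancel_bimod_iso (M N : bimodType S T) (f : bimod_hom M N) (g : N -> M) :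
  cancel f g -> cancel g f -> is_bimod_iso f.
Proof.
move=> fK gK; have f_inj := can_inj fK.
have gB : zmod_morphism g by move=> x y; apply: f_inj; rewrite linearB !gK.
have gZ : scalable g by move=> a x; apply: f_inj; rewrite linearZ !gK.
have gR x a : g (x :* a) = g x :* a by apply: f_inj; rewrite bimod_funR !gK.
by exists (build_hom gB gZ gR).
Qed.

Lemma tensor_sum (M : bimodType S T) (N : bimodType T U) (t : tensor M N) :
  exists n (a : 'I_n -> M) (b : 'I_n -> N), t = \sum_i tens (a i) (b i).
Proof.
suff [s ->] : exists s : seq (M * N), t = \sum_(p <- s) tens p.1 p.2.
  exists (size s), (fun i => (tnth (in_tuple s) i).1).
  by exists (fun i => (tnth (in_tuple s) i).2); rewrite big_tnth.
elim/tensor_ind: t => [a b|x y [s ->] [s' ->]].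
  by exists [:: (a, b)]; rewrite big_seq1.
exists (s ++ [seq (- p.1, p.2) | p <- s']).
rewrite big_cat big_map -sumrN; congr (_ + _); apply: eq_bigr => p _.
by rewrite -[- p.1]sub0r tensBl tens0l !sub0r.
Qed.

Lemma tens_suml (M : bimodType S T) (N : bimodType T U) (b : N) n (a : 'I_n -> M) :
  tens (\sum_i a i) b = \sum_i tens (a i) b.
Proof. exact: (big_morph (fun a : M => tens a b) (tensDl b) (tens0l _ b)). Qed.

Lemma tens_sumr (M : bimodType S T) (N : bimodType T U) (a : M) n (b : 'I_n -> N) :
  tens a (\sum_i b i) = \sum_i tens a (b i).
Proof. exact: (big_morph (fun b : N => tens a b) (tensDr a) (tens0r _ a)). Qed.

Lemma ract_suml (M : bimodType S T) n (x : 'I_n -> M) (t : T) :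
  (\sum_i x i) :* t = \sum_i x i :* t.
Proof. exact: (big_morph (fun x : M => x :* t) (ractDl t) (ract0l _ t)). Qed.

Lemma rhom_sum (M : bimodType T S) (N : bimodType U S) (h : rhom M N)
    n (x : 'I_n -> M) :
  h (\sum_i x i) = \sum_i h (x i).
Proof.
apply: (big_morph h (rhomD h)).
by apply: (addIr (h 0)); rewrite -rhomD !add0r.
Qed.

Lemma rhom_sumE (M : bimodType T S) (N : bimodType U S)
    n (h : 'I_n -> rhom M N) x :
  (\sum_i h i) x = \sum_i h i x.
Proof. exact: (big_morph (fun g : rhom M N => g x)). Qed.

End Bimodules.

(** A categorical isomorphism is stated with equalities of morphisms, a bimodule
    isomorphism with pointwise cancellation. *)
Lemma is_isoP (S : pzRingType) (M N : bimodType S S) (f : bimod_hom M N) :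
  @is_iso (bimod_category S) M N f <-> is_bimod_iso f.
Proof.
split=> [[g [gf fg]]|[g [fK gK]]]; exists g; split.
- exact: (fun x => congr1 (fun h : bimod_hom M M => h x) gf).
- exact: (fun x => congr1 (fun h : bimod_hom N N => h x) fg).
- exact: bimod_hom_ext.
- exact: bimod_hom_ext.
Qed.

(** * Triangle identities on elements *)

Section Zigzag.
Variables (S : pzRingType) (M : bimodType S S) (D : bimodType S S).

Definition contract_right (N : bimodType S S)
    (e : bimod_hom (tensor D M) (unit_bimod S)) :
    bimod_hom (tensor (tensor N D) M) N :=
  bimod_comp (tensor_runit N)
    (bimod_comp (tensor_hom (bimod_id N) e) (tensor_assoc N D M)).

Definition contract_left (e : bimod_hom (tensor D M) (unit_bimod S)) :
    bimod_hom (tensor D (tensor M D)) D :=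
  bimod_comp (tensor_lunit D)
    (bimod_comp (tensor_hom e (bimod_id D)) (tensor_assocV D M D)).

Lemma contract_rightE N e b d x :
  contract_right N e (tens (tens b d) x) = b :* (e (tens d x) : S).
Proof.
by rewrite /contract_right !bimod_compE tensor_assocE tensor_homE tensor_runitE.
Qed.

Lemma contract_leftE e d x d' :
  contract_left e (tens d (tens x d')) = (e (tens d x) : S) *: d'.
Proof.
by rewrite /contract_left !bimod_compE tensor_assocVE tensor_homE tensor_lunitE.
Qed.

(** The triangle identities evaluated at elements.  Since the coevaluation c is
    determined by c 1, the unit isomorphisms disappear. *)
Definition zigzag (e : bimod_hom (tensor D M) (unit_bimod S))
    (c : bimod_hom (unit_bimod S) (tensor M D)) : Prop :=
  (forall x, contract_right M e (tens (c 1) x) = x) /\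
  (forall d, contract_left e (tens d (c 1)) = d).

End Zigzag.

Lemma left_dual_zigzag (S : pzRingType) (M : bimodType S S)
    (D : @left_dual (bimod_category S) M) :
  @zigzag S M (dualO D : bimodType S S) (ev D) (coev D).
Proof.
split=> [x|d].
- rewrite -[RHS](congr1 (fun h : bimod_hom M M => h x) (ev_coev D)) /=.
  by rewrite [in RHS]tensor_liftE.
- rewrite -[RHS](congr1 (fun h : bimod_hom (dualO D : bimodType S S) _ => h d)
    (coev_ev D)) /=.
  by rewrite [in RHS]tensor_liftE.
Qed.

Lemma zigzag_left_dual (S : pzRingType) (M D : bimodType S S)
    (e : bimod_hom (tensor D M) (unit_bimod S))
    (c : bimod_hom (unit_bimod S) (tensor M D)) :
  zigzag e c -> @left_dual (bimod_category S) M.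
Proof.
move=> [ec ce].
apply: (@LeftDual (bimod_category S) M D e c); apply: bimod_hom_ext => x.
- by rewrite -[RHS]ec /= [in LHS]tensor_liftE.
- by rewrite -[RHS]ce /= [in LHS]tensor_liftE.
Qed.

(** * Tensoring with a dual is taking right linear maps *)

Section TensorDual.
Variables (S : pzRingType) (M D N : bimodType S S).
Variables (e : bimod_hom (tensor D M) (unit_bimod S)).
Variables (c : bimod_hom (unit_bimod S) (tensor M D)).
Hypothesis ec : zigzag e c.

Fact rhom_tensor_balanced (h : rhom M N) :
  balanced (fun (a : M) (d : D) => tens (h a) d).
Proof.
split=> [d a a'|a d d'|a s d] /=; first by rewrite rhomD tensDl.
  exact: tensDr.
by rewrite rhomR tens_balanced.
Qed.

(** The map h ⊗ 1.  It is only a map of groups in general, because a right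
    linear h need not be left linear; hence it is not a [tensor_hom]. *)
Definition rhom_tensor (h : rhom M N) : tensor M D -> tensor N D :=
  tensor_lift (rhom_tensor_balanced h).

Lemma rhom_tensorE h a d : rhom_tensor h (tens a d) = tens (h a) d.
Proof. exact: tensor_liftE. Qed.

Lemma rhom_tensorB h : {morph rhom_tensor h : x y / x - y}.
Proof. exact: tensor_lift_zmod. Qed.

Lemma rhom_tensorBl z : {morph rhom_tensor^~ z : g h / g - h}.
Proof.
move=> g h; elim/tensor_ind: z => [a d|x y IHx IHy].
  by rewrite !rhom_tensorE [X in tens X](_ : _ = g a - h a) // tensBl.
by rewrite !rhom_tensorB IHx IHy !opprD !opprK addrACA.
Qed.

Fact tensor_to_rhom_subproof (t : tensor N D) :
  (fun x => contract_right N e (tens t x)) \in @right_linearb S S S M N.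
Proof.
apply/right_linearbP/right_linearP => [x y|x a].
  by rewrite tensDr linearD.
by rewrite -tensR bimod_funR.
Qed.

Definition tensor_to_rhom (t : tensor N D) : rhom M N :=
  RHom (tensor_to_rhom_subproof t).

Lemma tensor_to_rhomE t x : tensor_to_rhom t x = contract_right N e (tens t x).
Proof. by []. Qed.

Definition rhom_to_tensor (h : rhom M N) : tensor N D := rhom_tensor h (c 1).

(** On c 1 = \sum_i a_i ⊗ d_i the composite is
    x |-> \sum_i h(a_i) e(d_i ⊗ x) = h(\sum_i a_i e(d_i ⊗ x)), and the
    argument of h is x by the first triangle identity. *)
Lemma rhom_to_tensorK : cancel rhom_to_tensor tensor_to_rhom.
Proof.
move=> h; apply: rhom_ext => x; rewrite tensor_to_rhomE.
rewrite -[in RHS](ec.1 x) /rhom_to_tensor.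
(* Here c 1 may be replaced by any tensor: only its occurrences on both sides
   have to agree. *)
elim/tensor_ind: (c 1) => [a d|y z IHy IHz].
  by rewrite rhom_tensorE !contract_rightE rhomR.
rewrite rhom_tensorB !tensBl !linearB IHy IHz.
by apply: (addIr (h (contract_right M e (tens z x)))); rewrite -rhomD !subrK.
Qed.

(** On b ⊗ d the composite gives
    \sum_i b e(d ⊗ a_i) ⊗ d_i = b ⊗ \sum_i e(d ⊗ a_i) d_i, and the second
    factor is d by the second triangle identity. *)
Lemma tensor_to_rhomK : cancel tensor_to_rhom rhom_to_tensor.
Proof.
move=> t; rewrite /rhom_to_tensor.
elim/tensor_ind: t => [b d|x y IHx IHy].
  rewrite -[in RHS](ec.2 d); elim/tensor_ind: (c 1) => [a d'|y z IHy IHz].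
    rewrite rhom_tensorE contract_leftE -tens_balanced; congr tens.
    exact: contract_rightE.
  by rewrite rhom_tensorB tensBr linearB tensBr IHy IHz.
have -> : tensor_to_rhom (x - y) = tensor_to_rhom x - tensor_to_rhom y.
  apply: rhom_ext => z; rewrite tensor_to_rhomE tensBl linearB.
  by rewrite -!tensor_to_rhomE.
by rewrite rhom_tensorBl IHx IHy.
Qed.

End TensorDual.

(** * The dual bimodule of right linear forms *)

Section DualBimodule.
Variables (S : pzRingType) (M : bimodType S S).
Local Notation D := (rhom M (unit_bimod S)).

Fact rhom_ev_balanced : balanced (fun (h : D) (x : M) => h x).
Proof. by split=> // h x y; rewrite rhomD. Qed.

Definition rhom_ev : bimod_hom (tensor D M) (unit_bimod S) :=
  tensor_lift_hom rhom_ev_balanced (fun _ _ _ => erefl) (@rhomR _ _ _ _ _).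

Lemma rhom_evE (h : D) x : rhom_ev (tens h x) = h x.
Proof. exact: tensor_liftE. Qed.

Variables (n : nat) (v : 'I_n -> M) (c : 'I_n -> D).
Hypothesis vc : forall x, x = \sum_i v i :* (c i x : S).

Lemma rhom_dual_basis (h : D) : h = \sum_i (h (v i) : S) *: c i.
Proof.
apply: rhom_ext => x; rewrite [in LHS](vc x) rhom_sum rhom_sumE.
by apply: eq_bigr => i _; rewrite rhomR.
Qed.

(** Under the identification of M ⊗ D with the right linear endomorphisms of M,
    this is the identity map, whence its centrality. *)
Definition casimir : tensor M D := \sum_i tens (v i) (c i).

Lemma casimir_ract s : casimir :* s = \sum_i tens (v i) (c i :* s).
Proof.
by rewrite ract_suml; apply: eq_bigr => i _; rewrite tensR.
Qed.

(** Expand c_i s in the c_j, with coefficients c_i(s v_j), move these across the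
    tensor sign, and recognize \sum_i v_i c_i(s v_j) = s v_j. *)
Lemma casimir_central s : s *: casimir = casimir :* s.
Proof.
rewrite casimir_ract scaler_sumr.
under [RHS]eq_bigr do rewrite [c _ :* s]rhom_dual_basis tens_sumr.
rewrite exchange_big; apply: eq_bigr => j _ /=.
under [RHS]eq_bigr do rewrite -tens_balanced.
by rewrite -tens_suml -vc tensZ.
Qed.

Let coev_fun (s : unit_bimod S) : tensor M D := (s : S) *: casimir.

Fact coev_zmod : zmod_morphism coev_fun.
Proof. by move=> s t; apply: scalerBl. Qed.

Fact coev_scale : scalable coev_fun.
Proof. by move=> s t; rewrite /coev_fun scalerA. Qed.

Fact coev_ract s t : coev_fun (s :* t) = coev_fun s :* t.
Proof. by rewrite /coev_fun -scale_ract -casimir_central scalerA. Qed.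

Definition rhom_coev : bimod_hom (unit_bimod S) (tensor M D) :=
  build_hom coev_zmod coev_scale coev_ract.

Lemma rhom_coev1 : rhom_coev 1 = \sum_i tens (v i) (c i).
Proof. exact: scale1r. Qed.

Lemma rhom_zigzag : zigzag rhom_ev rhom_coev.
Proof.
split=> [x|h]; rewrite rhom_coev1.
  rewrite tens_suml linear_sum [RHS]vc; apply: eq_bigr => i _.
  by rewrite contract_rightE rhom_evE.
rewrite tens_sumr linear_sum [RHS]rhom_dual_basis; apply: eq_bigr => i _.
by rewrite contract_leftE rhom_evE.
Qed.

End DualBimodule.

(** * The Frobenius map as r |-> n(r -) *)

Section FrobeniusMap.
Variables (R : pzRingType) (P : {pred R}) (S : subPzRingType P).
Variables (N : bimodType S S).
Local Notation A := (ext_SS S).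

Fact translate_right_linear (n : bimod_hom A N) (r : ext_SR S) :
  (fun x : ext_RS S => n ((r : R) * (x : R))) \in @right_linearb R S S (ext_RS S) N.
Proof.
apply/right_linearbP/right_linearP => [x y|x a].
  by rewrite mulrDr linearD.
by rewrite -bimod_funR; congr (n _); apply: mulrA.
Qed.

Let translate_fun n r := RHom (translate_right_linear n r).

Fact translate_zmod n : zmod_morphism (translate_fun n).
Proof.
move=> r s; apply: rhom_ext => x /=.
rewrite [RHS](_ : _ = n ((r : R) * (x : R)) - n ((s : R) * (x : R))) //.
by rewrite -linearB; congr (n _); apply: mulrBl.
Qed.

Fact translate_scale n : scalable (translate_fun n).
Proof.
move=> s r; apply: rhom_ext => x; rewrite rhomZE /= -linearZ; congr (n _).
by rewrite [RHS]mulrA.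
Qed.

Fact translate_ract n r a : translate_fun n (r :* a) = translate_fun n r :* a.
Proof. by apply: rhom_ext => x; rewrite rhomRE; congr (n _); rewrite [RHS]mulrA. Qed.

Definition translate_hom (n : bimod_hom A N) :
    bimod_hom (ext_SR S) (rhom (ext_RS S) N) :=
  build_hom (@translate_zmod n) (@translate_scale n) (@translate_ract n).

(** Since r = 1 r, right R-linearity gives f(r) = f(1) r = f(1)(r -).  The map
    f(1) is left S-linear because s f(1) = f(s 1) = f(1 s) = f(1)(s -). *)
Lemma translate_hom_value1 (f : bimod_hom (ext_SR S) (rhom (ext_RS S) N)) :
  exists n : bimod_hom A N, f = translate_hom n.
Proof.
have fE (r x : R) : f r x = f 1 (r * x).
  by rewrite -[r in LHS]mul1r [_ * _](_ : _ = (1 : ext_SR S) :* r) // bimod_funR.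
pose n (x : A) : N := f 1 x.
have nB : zmod_morphism n.
  move=> x y; apply: (addIr (n y)); rewrite subrK.
  by rewrite -[LHS]rhomD; congr (f 1 _); apply: subrK.
have nZ : scalable n.
  move=> s x; rewrite /n -rhomZE -linearZ.
  by rewrite [RHS]fE; congr (f 1 (_ * _)); rewrite rbZE mulr1.
have nR x a : n (x :* a) = n x :* a by rewrite /n -rhomR.
exists (build_hom nB nZ nR); apply: bimod_hom_ext => r.
by apply: rhom_ext => x; rewrite fE.
Qed.

(** Right linear maps out of R form a different type according to whether R is
    seen as an R-S- or as an S-S-bimodule, since the left structure is part of
    the bimodule; [restrict] and [unrestrict] pass between the two. *)
Fact restrict_subproof (h : rhom (ext_RS S) N) :
  (h : A -> N) \in @right_linearb S S S A N.
Proof.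
by apply/right_linearbP/right_linearP => [x y|x a]; [apply: rhomD | apply: rhomR].
Qed.

Definition restrict (h : rhom (ext_RS S) N) : rhom A N := RHom (restrict_subproof h).

Fact unrestrict_subproof (h : rhom A N) :
  (h : ext_RS S -> N) \in @right_linearb R S S (ext_RS S) N.
Proof.
by apply/right_linearbP/right_linearP => [x y|x a]; [apply: rhomD | apply: rhomR].
Qed.

Definition unrestrict (h : rhom A N) : rhom (ext_RS S) N :=
  RHom (unrestrict_subproof h).

Lemma restrictK : cancel restrict unrestrict.
Proof. by move=> h; apply: rhom_ext. Qed.
Lemma unrestrictK : cancel unrestrict restrict.
Proof. by move=> h; apply: rhom_ext. Qed.

Variables (n : bimod_hom A N) (D : @left_dual (bimod_category S) A).

(** On c 1 = \sum_i a_i ⊗ d_i both sides are \sum_i n(r a_i) ⊗ d_i. *)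
Lemma Frobenius_mapE (r : R) :
  (@Frobenius_map (bimod_category S) (ext_algebra S) D N n
     : bimod_hom A (tensor N (dualO D : bimodType S S))) r =
  rhom_to_tensor (coev D) (restrict (translate_hom n r)).
Proof.
pose B : bimodType S S := dualO D.
pose F : bimod_hom (tensor A (tensor A B)) (tensor N B) :=
  bimod_comp (tensor_hom (bimod_comp n (ext_mul S)) (bimod_id B))
    (tensor_assocV A A B).
rewrite [LHS](_ : _ = F (tens (r : A) ((coev D : bimod_hom _ (tensor A B)) 1)));
  last by rewrite /Frobenius_map /= [in LHS]tensor_liftE.
rewrite /rhom_to_tensor; elim/tensor_ind: (_ 1) => [a d|x y IHx IHy].
  by rewrite bimod_compE tensor_assocVE tensor_homE rhom_tensorE bimod_compE ext_mulE.
by rewrite tensBr linearB rhom_tensorB IHx IHy.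
Qed.

Lemma Frobenius_map_iso :
  @is_iso (bimod_category S) _ _
    (@Frobenius_map (bimod_category S) (ext_algebra S) D N n) <->
  is_bimod_iso (translate_hom n).
Proof.
have zz := left_dual_zigzag D.
have toK := @rhom_to_tensorK S A _ N _ _ zz.
have ofK := @tensor_to_rhomK S A _ N _ _ zz.
split=> [/is_isoP|] [g [fK gK]].
- pose g' (h : rhom (ext_RS S) N) : ext_SR S :=
    g (rhom_to_tensor (coev D) (restrict h)).
  apply: (@cancel_bimod_iso _ _ _ _ _ g') => [r|h].
    by rewrite /g' -Frobenius_mapE fK.
  apply: (can_inj restrictK); apply: (can_inj toK).
  by rewrite -Frobenius_mapE gK.
- pose g' (t : tensor N (dualO D : bimodType S S)) : A :=
    g (unrestrict (tensor_to_rhom (ev D) t)).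
  apply/is_isoP; apply: (@cancel_bimod_iso _ _ _ _ _ g') => [r|t].
    by rewrite /g' Frobenius_mapE toK restrictK fK.
  by rewrite Frobenius_mapE gK unrestrictK ofK.
Qed.

End FrobeniusMap.

(** * Dualizable extensions *)

Section Dualizable.
Variables (R : pzRingType) (P : {pred R}) (S : subPzRingType P).
Local Notation A := (ext_SS S).

Lemma left_dual_fg_projective (D : @left_dual (bimod_category S) A) :
  finitely_generated (right_module (ext_RS S)) /\
  projective (right_module (ext_RS S)).
Proof.
have [zig _] := left_dual_zigzag D.
set e := (ev D : bimod_hom (tensor (dualO D : bimodType S S) A) (unit_bimod S)) in zig.
have [m [a [d ad]]] := tensor_sum ((coev D : bimod_hom (unit_bimod S) _) 1).
have xE (x : A) : x = \sum_i a i :* (e (tens (d i) x) : S).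
  rewrite -[LHS]zig ad tens_suml linear_sum; apply: eq_bigr => i _.
  by rewrite contract_rightE.
pose c i (x : right_module (ext_RS S)) : (S^c)^o := e (tens (d i) (x : A)).
have cB i : zmod_morphism (c i).
  by move=> x y; rewrite /c -linearB; congr (e _); apply: tensBr.
have cZ i : scalable (c i).
  move=> s x; rewrite /c [RHS](_ : _ = e (tens (d i) (x : A)) :* s) //.
  by rewrite -bimod_funR tensR.
split.
  exists m, (fun i => a i : right_module (ext_RS S)) => x.
  by exists (c^~ x); apply: xE.
exact: (@dual_basis_projective _ _ m (fun i => a i : right_module (ext_RS S))
  (fun i => linear_of (cB i) (cZ i))).
Qed.

Lemma fg_projective_left_dual :
  finitely_generated (right_module (ext_RS S)) ->
  projective (right_module (ext_RS S)) ->
  inhabited (@left_dual (bimod_category S) A).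
Proof.
move=> fg proj; have [m [v [c vc]]] := fg_projective_dual_basis fg proj.
have c_lin i : (c i : A -> unit_bimod S) \in @right_linearb S S S A (unit_bimod S).
  apply/right_linearbP/right_linearP => [x y|x a]; first exact: (linearD (c i)).
  exact: (linearZ_LR (c i) a (x : right_module (ext_RS S))).
split; apply: zigzag_left_dual.
exact: (@rhom_zigzag S A m v (fun i => RHom (c_lin i)) vc).
Qed.

End Dualizable.

(** * Twisted Frobenius extensions and Frobenius structures *)

Theorem proposition2p18 (R : pzRingType) (P : {pred R}) (S : subPzRingType P)
    (beta : {rmorphism S -> S}) (beta_bij : bijective beta) :
  beta_Frobenius_extension beta <->
  exists n : @mor (bimod_category S) (ext_SS S) (twisted_bimod beta),
    @Frobenius_structure (bimod_category S) (ext_algebra S)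
      (twisted_bimod beta) n.
Proof.
split=> [[fg proj [f f_iso]]|[n [D n_iso]]].
- have [n fE] := translate_hom_value1 f; have [D] := fg_projective_left_dual fg proj.
  by exists n, D; apply/Frobenius_map_iso; rewrite -fE.
- have [fg proj] := left_dual_fg_projective D.
  by split=> //; exists (translate_hom n); apply/(Frobenius_map_iso n D).
Qed.
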